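(* Let $f:\mathbb R^d\to\mathbb R^c$ admit a continuous $(H,G)$-equivariance, where $H:\mathbb R^d\times\mathbb R^p\to\mathbb R^d$ and $G:\mathbb R^c\times\mathbb R^p\to\mathbb R^c$, let $\ell:\mathbb R^c\to\mathbb R$ be smooth, and let $L=\ell\circ f$. Let $(\theta,\lambda)\in\mathbb R^d\times\mathbb R^p$ be a good position. Write $y=f(\theta)$, and put $$X=\nabla_\theta H(\theta,\lambda)^{-1}\circ\nabla_\lambda H(\theta,\lambda),\qquad Y=\nabla_y G(y,\lambda)^{-1}\circ\nabla_\lambda G(y,\lambda).$$ Then the following hold (all derivatives of $H$ are evaluated at $(\theta,\lambda)$, and all derivatives of $G$ at $(y,\lambda)$). 1. (First-order identity) $$\text{(i)}\quad \nabla L(\theta)\circ X=\nabla\ell(y)\circ Y .$$ 2. (Second-order identities) $$\begin{aligned}\text{(ii)}\quad \nabla^2L(\theta)\circ X=\;&\nabla^2\ell(y)\circ Y\circ_2\nabla f(\theta)\\&-\nabla\ell(y)\circ\nabla f(\theta)\circ(\nabla_\theta H)^{-1}\circ\nabla_\lambda\nabla_\theta H\\&+\nabla\ell(y)\circ\nabla f(\theta)\circ(\nabla_\theta H)^{-1}\circ\nabla_\theta^2H\circ X\\&+\nabla\ell(y)\circ(\nabla_yG)^{-1}\circ\nabla_\lambda\nabla_yG\circ_2\nabla f(\theta)\\&-\nabla\ell(y)\circ(\nabla_yG)^{-1}\circ\nabla_y^2G\circ Y\circ_2\nabla f(\theta),\end{aligned}$$ $$\begin{aligned}\text{(iii)}\quad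 \nabla^2L(\theta)\circ X\circ_2X=\;&\nabla^2\ell(y)\circ Y\circ_2Y\\&-\nabla\ell(y)\circ\nabla f(\theta)\circ(\nabla_\theta H)^{-1}\circ\nabla_\lambda^2H\\&+\nabla\ell(y)\circ\nabla f(\theta)\circ(\nabla_\theta H)^{-1}\circ\nabla_\theta^2H\circ X\circ_2X\\&+\nabla\ell(y)\circ(\nabla_yG)^{-1}\circ\nabla_\lambda^2G\\&-\nabla\ell(y)\circ(\nabla_yG)^{-1}\circ\nabla_y^2G\circ Y\circ_2Y.\end{aligned}$$
   Context: Equivariance. $f$ admits an $(H,G)$-equivariance if $f$, $H(\cdot,\lambda)$ and $G(\cdot,\lambda)$ are smooth for every $\lambda\in\mathbb R^p$ and $f(H(\theta,\lambda))=G(f(\theta),\lambda)$ for all $\theta\in\mathbb R^d$, $\lambda\in\mathbb R^p$. It is continuous if moreover $H$ and $G$ are smooth in $\lambda$; this is understood as $H$ and $G$ being jointly smooth in both arguments, so that the mixed derivatives below exist. A pair $(\theta,\lambda)$ is a good position if both $\nabla_\theta H(\theta,\lambda)$ and $\nabla_yG(f(\theta),\lambda)$ are invertible linear maps. $\nabla_\theta H,\nabla_\lambda H$ denote the Fréchet derivatives of $H$ in its first and second arguments; $\nabla_yG,\nabla_\lambda G$ those of $G$. Tensor notation. A tensor of shape $(n)$ is a linear map $\mathbb R^n\to\mathbb R$ (identified with a vector of $\mathbb R^n$), and a tensor of shape $(n,s)$ is a linear map from $\mathbb R^n$ to the tensors of shape $s$; $\mathbb T(s)$ is the set of tensors of shape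 $s$ (a linear map $\mathbb R^n\to\mathbb R^m$ is an element of $\mathbb T(n,m)$). For a function $F:\mathbb R^n\to\mathbb T(s)$, $\nabla F:\mathbb R^n\to\mathbb T(n,s)$ is its Fréchet derivative, the new differentiation direction being the first input slot. For a shape $t$, if $A\in\mathbb T(t,b)$ and $B\in\mathbb T(b,s)$, then $B\circ A\in\mathbb T(t,s)$ is obtained by feeding the $\mathbb R^b$-valued output of $A$ into the first slot of $B$. The second-component composition is $(B\circ_2A)(x)=B(x)\circ A$, i.e. $A$ is fed into the second slot of $B$. Chains of $\circ,\circ_2$ are read left to right. Thus (i) is an identity in $\mathbb T(p)$, (ii) in $\mathbb T(p,d)$ and (iii) in $\mathbb T(p,p)$. For example, evaluated at $u\in\mathbb R^p$ and $v\in\mathbb R^d$, the terms of (ii) are: left side $D^2L(\theta)[Xu,v]$; right side, in order, $D^2\ell(y)[Yu,Df(\theta)v]$; $-D\ell(y)\,Df(\theta)\,(D_\theta H)^{-1}\,D_\lambda D_\theta H[u,v]$; $D\ell(y)\,Df(\theta)\,(D_\theta H)^{-1}\,D_\theta^2H[Xu,v]$; $D\ell(y)\,(D_yG)^{-1}\,D_\lambda D_yG[u,Df(\theta)v]$; $-D\ell(y)\,(D_yG)^{-1}\,D_y^2G[Yu,Df(\theta)v]$. Similarly (iii) is evaluated at $u,u'\in\mathbb R^p$, with $A\circ X\circ_2X$ meaning $A[Xu,Xu']$, $A\circ Y\circ_2 Y$ meaning $A[Yu,Yu']$, and $\nabla_\lambda^2H,\nabla_\lambda^2G$ evaluated at $[u,u']$.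 *)

(* Defs.v *)
From HB Require Import structures.
From mathcomp Require Import all_boot all_order all_algebra.
From mathcomp Require Import boolp classical_sets reals topology normedtype derive.

Set Implicit Arguments.
Unset Strict Implicit.
Unset Printing Implicit Defensive.

Import Order.TTheory GRing.Theory Num.Theory.
Import numFieldNormedType.Exports.

Import VectorInternalTheory.

Local Open Scope ring_scope.

(* Finite-dimensional normed spaces.  The structure is needed because the space
   'Hom(U, V) of linear maps is a vectType in the library but carries no norm,
   so that the differential cannot be iterated as a map into it. *)
#[short(type="normedVectType")]
HB.structure Definition NormedVector (R : realType) :=
  {V of Vector R V & NormedModule R V}.

Section HomNorm.
Variables (R : realType) (U V : vectType R).

(* Largest absolute value of a matrix coefficient.  All norms on 'Hom(U, V) are
   equivalent, so Frechet derivatives of 'Hom(U, V)-valued maps do not depend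
   on this choice. *)
Definition hom_norm (A : 'Hom(U, V)) : R := `|f2mx A|.

Lemma v2r_lfunE (A : 'Hom(U, V)) x : v2r (A x) = v2r x *m f2mx A.
Proof. by rewrite unlock /= r2vK. Qed.

Lemma f2mx_linear : linear (@f2mx R U V).
Proof.
move=> a A B; apply/row_matrixP => i; rewrite !rowE mulmxDr -scalemxAr.
rewrite -[delta_mx 0 i]r2vK -!v2r_lfunE add_lfunE scale_lfunE.
exact: linearP.
Qed.

Lemma f2mx0 : f2mx (0 : 'Hom(U, V)) = 0.
Proof. by have := f2mx_linear (-1) 0 0; rewrite scaler0 addr0 scaleN1r addNr. Qed.

Lemma hom_normD A B : hom_norm (A + B) <= hom_norm A + hom_norm B.
Proof.
by rewrite /hom_norm -{1}[A]scale1r f2mx_linear scale1r ler_normD.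
Qed.

Lemma hom_normZ (a : R) A : hom_norm (a *: A) = `|a| * hom_norm A.
Proof.
by rewrite /hom_norm -[a *: A]addr0 f2mx_linear f2mx0 addr0 normrZ.
Qed.

Lemma hom_norm0_eq0 A : hom_norm A = 0 -> A = 0.
Proof.
move=> /normr0_eq0 A0; apply/lfunP => x.
by apply: (can_inj v2rK); rewrite !v2r_lfunE A0 f2mx0 !mulmx0.
Qed.

HB.instance Definition _ :=
  Lmodule_isNormed.Build R 'Hom(U, V) hom_normD hom_normZ hom_norm0_eq0.
End HomNorm.

HB.instance Definition _ (R : realType) (m n : nat) :=
  NormedModule.on 'M[R]_(m, n).
HB.instance Definition _ (R : realType) := NormedModule.on (Real.sort R).
HB.instance Definition _ (R : realType) (U V : normedVectType R) :=
  NormedModule.on (U * V)%type.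

(* Frechet derivative as a map into 'Hom(U, V); the tensors of shape (n, s) are
   'Hom('rV[R]_n, W) with W the space of tensors of shape s, the spaces of
   shapes () and (m) being R and, for vector-valued maps, 'rV[R]_m. *)
Definition nabla (R : realType) (U V : normedVectType R) (F : U -> V) (x : U) :
  'Hom(U, V) := linfun ('d F x).

Section Smooth.
Variables (R : realType) (U : normedVectType R).

Fixpoint diff_times (k : nat) (V : normedVectType R) (F : U -> V) : Prop :=
  if k is k'.+1 then (forall x, differentiable F x) /\ diff_times k' (nabla F)
  else True.

Definition smooth (V : normedVectType R) (F : U -> V) : Prop :=
  forall k, diff_times k F.
End Smooth.

Section Partial.
Variables (R : realType) (U U' V : normedVectType R).

Definition nabla1 (F : U -> U' -> V) (x : U) (l : U') : 'Hom(U, V) :=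
  nabla (F^~ l) x.

Definition nabla2 (F : U -> U' -> V) (x : U) (l : U') : 'Hom(U', V) :=
  nabla (F x) l.
End Partial.

Section Composition.
Variables (R : realType) (T1 T2 V W : vectType R).

(* The composition of B after A when the shape t of the remaining inputs of A
   has two entries; for a single entry it is the library's (B \o A)%VF. *)
Definition comp_out (B : 'Hom(V, W)) (A : 'Hom(T1, 'Hom(T2, V))) :
  'Hom(T1, 'Hom(T2, W)) := linfun (fun x => (B \o A x)%VF).

Definition comp_snd (B : 'Hom(T1, 'Hom(V, W))) (A : 'Hom(T2, V)) :
  'Hom(T1, 'Hom(T2, W)) := linfun (fun x => (B x \o A)%VF).

Lemma comp_outE B A x v : comp_out B A x v = B (A x v).
Proof.
have lin : linear (fun x => (B \o A x)%VF).
  by move=> a y z; rewrite linearP comp_lfunDr comp_lfunZr.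
pose m := GRing.isLinear.Build _ _ _ _ _ lin.
pose F : {linear T1 -> 'Hom(T2, W)} := HB.pack (fun x => (B \o A x)%VF) m.
by rewrite /comp_out (lfunE F) comp_lfunE.
Qed.

Lemma comp_sndE B A x v : comp_snd B A x v = B x (A v).
Proof.
have lin : linear (fun x => (B x \o A)%VF).
  by move=> a y z; rewrite linearP comp_lfunDl comp_lfunZl.
pose m := GRing.isLinear.Build _ _ _ _ _ lin.
pose F : {linear T1 -> 'Hom(T2, W)} := HB.pack (fun x => (B x \o A)%VF) m.
by rewrite /comp_snd (lfunE F) comp_lfunE.
Qed.
End Composition.

Notation "B \o_t A" := (comp_out B A)
  (at level 50, left associativity) : lfun_scope.
Notation "B \o_2 A" := (comp_snd B A)
  (at level 50, left associativity) : lfun_scope.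

Section Equivariance.
Variables (R : realType) (d c p : nat).
Implicit Types (f : 'rV[R]_d -> 'rV[R]_c).
Implicit Types (H : 'rV[R]_d -> 'rV[R]_p -> 'rV[R]_d).
Implicit Types (G : 'rV[R]_c -> 'rV[R]_p -> 'rV[R]_c).

Definition equivariance f H G : Prop :=
  [/\ smooth f, forall lambda, smooth (H^~ lambda), forall lambda, smooth (G^~ lambda) &
      forall theta lambda, f (H theta lambda) = G (f theta) lambda].

Definition continuous_equivariance f H G : Prop :=
  [/\ equivariance f H G, smooth (fun z => H z.1 z.2) &
      smooth (fun z => G z.1 z.2)].

Definition good_position f H G theta lambda : Prop :=
  bijective (nabla1 H theta lambda) /\ bijective (nabla1 G (f theta) lambda).
End Equivariance.

(* Main.v *)
(* Differentiating f (H theta lambda) = G (f theta) lambda once gives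
   f'(H) H_theta = G_y f'(theta) and f'(H) H_lambda = G_lambda, whence
   f'(theta) X = Y.  Differentiating these two relations again, in theta along
   X u and in lambda along u, produces the same term f''(H)[H_lambda u, _],
   because H_theta X = H_lambda; the difference expresses f''(theta)[X u, _] through
   the derivatives of H and G, and the chain rule transfers this to L.
   Continuity of linear maps out of an abstract finite-dimensional space is what
   makes evaluation and composition of 'Hom-valued maps differentiable. *)
Require Import Defs.
From HB Require Import structures.
From mathcomp Require Import all_boot all_order all_algebra.
From mathcomp Require Import boolp classical_sets reals topology normedtype derive.

Set Implicit Arguments.
Unset Strict Implicit.
Unset Printing Implicit Defensive.

Import Order.TTheory GRing.Theory Num.Theory.
Import numFieldNormedType.Exports.

Local Open Scope ring_scope.
Import VectorInternalTheory.

(** * Continuity of linear maps and of evaluation in finite dimension *)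

Section FiniteDimensional.
Variables (R : realType).

Lemma continuous_sum_scale (T : topologicalType) (W : normedModType R) (n : nat)
  (a : 'I_n -> T -> R) (F : 'I_n -> T -> W) :
  (forall j, continuous (a j)) -> (forall j, continuous (F j)) ->
  continuous (fun x => \sum_j a j x *: F j x).
Proof.
move=> ca cF; apply: continuous_big.
  exact: add_continuous.
by move=> j _ x; apply: cvgZ; [exact: ca|exact: cF].
Qed.

Lemma r2v_continuous (V : normedVectType R) : continuous (@r2v R V).
Proof.
have -> : @r2v R V = fun w => \sum_j w 0 j *: r2v (delta_mx 0 j).
  apply/funext => w; rewrite [in LHS](row_sum_delta w) linear_sum /=.
  by apply: eq_bigr => j _; rewrite linearZ.
apply: continuous_sum_scale => j; first exact: coord_continuous.
exact: cst_continuous.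
Qed.

(** The norm of [V] is arbitrary, so this is one half of the equivalence of norms; it rests on
    compactness of the unit sphere of coordinates. *)
Lemma v2r_continuous (V : normedVectType R) : continuous (@v2r R V).
Proof.
suff [k kP] : exists k : R, forall v : V, `|v2r v| <= k * `|v|.
  apply: bounded_linear_continuous; apply/linear_boundedP.
  exists k; split; first exact: num_real.
  move=> r kr v; apply: le_trans (kP v) _.
  by apply: ler_wpM2r => //; exact: ltW.
(* The continuous map w |-> |r2v w| has a positive minimum on the sphere S. *)
pose S := [set w : 'rV[R]_(dim V) | `|w| = 1]%classic.
have normS (v : V) : v != 0 -> S (`|v2r v|^-1 *: v2r v).
  move=> v0; rewrite /S /= normrZ normfV normr_id mulVf // normr_eq0.
  by apply: contra v0 => /eqP v0; rewrite -(v2rK v) v0 linear0.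
(* An empty sphere means that [V] is the zero space, where [k = 0] serves. *)
have [[w0 Sw0]|S0] := pselect ((S !=set0)%classic); last first.
  exists 0 => v; have [->|v0] := eqVneq v 0.
    by rewrite linear0 !normr0 mulr0.
  by case: S0; exists (`|v2r v|^-1 *: v2r v); exact: normS.
have cS : compact S.
  apply: bounded_closed_compact.
    by exists 1; split; [exact: num_real|move=> M M1 w /= ->; exact: ltW].
  apply: (@preimage_closed _ _ (fun w : 'rV[R]_(dim V) => `|w|)
                           [set x | x = 1]%classic).
    by move=> w _; exact: norm_continuous.
  exact: closed_eq.
have [|w Sw wmin] :=
    @EVT_min_rV R _ (fun w => `|r2v w : V|) _ (ex_intro _ w0 Sw0) cS.
  apply: continuous_subspaceT => w.
  by apply: continuous_comp; [exact: r2v_continuous|exact: norm_continuous].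
(* By injectivity of [r2v] a zero minimum would force [w = 0], which is off the sphere. *)
have w1 : 0 < `|r2v w : V|.
  rewrite normr_gt0; apply/eqP => rw0; move: Sw.
  rewrite inE /S /= -(r2vK w) rw0 linear0 normr0 => /esym/eqP.
  by rewrite oner_eq0.
(* By homogeneity, comparing the minimum with the value at the normalised coordinates of [v] makes
   its inverse an admissible constant. *)
exists `|r2v w : V|^-1 => v.
have [->|v0] := eqVneq v 0; first by rewrite linear0 !normr0 mulr0.
have v1 : 0 < `|v2r v|.
  rewrite normr_gt0; apply: contra v0 => /eqP v0.
  by rewrite -(v2rK v) v0 linear0.
have := wmin _ (mem_set (normS _ v0)).
rewrite linearZ /= v2rK normrZ normfV normr_id ler_pdivlMl // ler_pdivlMl //.
by rewrite mulrC.
Qed.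

(** The map factors through [v2r], followed by a finite sum of coordinate functions times fixed
    vectors. *)
Lemma linear_findim_continuous (U : normedVectType R) (W : normedModType R)
  (f : {linear U -> W}) : continuous f.
Proof.
pose g (w : 'rV[R]_(dim U)) := \sum_j w 0 j *: f (r2v (delta_mx 0 j)).
have -> : f = g \o v2r :> (U -> W).
  apply/funext => u /=; rewrite /g -[in LHS](v2rK u).
  rewrite [in LHS](row_sum_delta (v2r u)) !linear_sum /=.
  by apply: eq_bigr => j _; rewrite !linearZ.
have cg : continuous g.
  apply: continuous_sum_scale => j; first exact: coord_continuous.
  exact: cst_continuous.
move=> u; apply: (@continuous_comp _ _ _ _ g); last exact: cg.
exact: v2r_continuous.
Qed.

(* A named constant is needed to carry the bilinear structure. *)
Definition app_lfun (U V : vectType R) (A : 'Hom(U, V)) (u : U) : V := A u.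

Lemma app_lfun_bilinear (U V : vectType R) :
  bilinear_for (GRing.Scale.Law.clone _ _ *:%R _)
    (GRing.Scale.Law.clone _ _ *:%R _) (@app_lfun U V).
Proof.
split=> [u a A B|A a u v] /=; first by rewrite /app_lfun add_lfunE scale_lfunE.
exact: linearP.
Qed.

HB.instance Definition _ (U V : vectType R) :=
  bilinear_isBilinear.Build R _ _ _ _ _ (@app_lfun U V)
    (@app_lfun_bilinear U V).

Lemma app_lfun_continuousl (U V : normedVectType R) (u : U) :
  continuous (fun A : 'Hom(U, V) => A u).
Proof.
have lin : linear (fun A : 'Hom(U, V) => A u).
  by move=> a A B; rewrite add_lfunE scale_lfunE.
pose m := GRing.isLinear.Build _ _ _ _ _ lin.
exact: (@linear_findim_continuous _ _ (HB.pack (fun A : 'Hom(U, V) => A u) m)).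
Qed.

(** Expanding the argument in coordinates leaves only evaluations at fixed vectors, which are linear
    in the map. Joint continuity is what the differentiation of a bilinear map requires. *)
Lemma app_lfun_continuous (U V : normedVectType R) :
  continuous (fun p : 'Hom(U, V) * U => app_lfun p.1 p.2).
Proof.
pose g (p : 'Hom(U, V) * U) := \sum_j v2r p.2 0 j *: p.1 (r2v (delta_mx 0 j)).
have -> : (fun p : 'Hom(U, V) * U => app_lfun p.1 p.2) = g.
  apply/funext => -[A u]; rewrite /g /app_lfun /= -[in LHS](v2rK u).
  rewrite [in LHS](row_sum_delta (v2r u)) !linear_sum /=.
  by apply: eq_bigr => j _; rewrite !linearZ.
apply: continuous_sum_scale => j p.
  apply: (@continuous_comp _ _ _ (fun p : 'Hom(U, V) * U => v2r p.2)
    (fun w => w 0 j)); last exact: coord_continuous.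
  by apply: continuous_comp; [exact: cvg_snd|exact: v2r_continuous].
apply: (@continuous_comp _ _ _ fst (fun A : 'Hom(U, V) => A _)).
  exact: cvg_fst.
exact: app_lfun_continuousl.
Qed.

(** * First-order calculus of [nabla] *)

Lemma lin_differentiable (U : normedVectType R) (W : normedModType R)
  (f : {linear U -> W}) x : differentiable f x.
Proof. by apply: linear_differentiable; exact: linear_findim_continuous. Qed.

Lemma nablaE (U V : normedVectType R) (F : U -> V) x u : nabla F x u = 'd F x u.
Proof. by rewrite /nabla lfunE. Qed.

Lemma nabla_comp (U V W : normedVectType R) (F : U -> V) (K : V -> W) x :
  differentiable F x -> differentiable K (F x) ->
  (nabla (K \o F) x = nabla K (F x) \o nabla F x)%VF.
Proof.
move=> dF dK; apply/lfunP => u.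
by rewrite comp_lfunE !nablaE diff_comp.
Qed.

Section Apply.
Variables (U V W : normedVectType R) (F : U -> 'Hom(V, W)) (b : U -> V) (x : U).
Hypotheses (dF : differentiable F x) (db : differentiable b x).

Let pairE : (fun z => F z (b z)) =
  (fun p : 'Hom(V, W) * V => app_lfun p.1 p.2) \o (fun z => (F z, b z)).
Proof. by []. Qed.

Lemma differentiable_apply : differentiable (fun z => F z (b z)) x.
Proof.
rewrite pairE; apply: differentiable_comp; first exact: differentiable_pair.
by apply: differentiable_bilin; exact: app_lfun_continuous.
Qed.

(** Leibniz rule for the bilinear evaluation after [z |-> (F z, b z)]. *)
Lemma nabla_apply u :
  nabla (fun z => F z (b z)) x u = nabla F x u (b x) + F x (nabla b x u).
Proof.
rewrite !nablaE pairE diff_comp /=; last 2 first.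
- exact: differentiable_pair.
- by apply: differentiable_bilin; exact: app_lfun_continuous.
rewrite diff_pair // diff_bilin /=; last exact: app_lfun_continuous.
by rewrite addrC.
Qed.
End Apply.

Lemma nabla_cst (U V : normedVectType R) (a : V) (x : U) :
  nabla (fun=> a) x = 0.
Proof. by apply/lfunP => u; rewrite nablaE (diff_cst a) lfunE. Qed.

Lemma nabla_apply_cst (U V W : normedVectType R) (F : U -> 'Hom(V, W)) v x u :
  differentiable F x -> nabla (fun z => F z v) x u = nabla F x u v.
Proof.
move=> dF; rewrite (@nabla_apply _ _ _ F (fun=> v)) //.
by rewrite nabla_cst zero_lfunE linear0 addr0.
Qed.

(** Composition is a case of evaluation: [C] acts on [D] by the linear map [D |-> C \o D], which
    itself depends linearly on [C]. *)
Lemma differentiable_comp_lfun (U T V W : normedVectType R)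
  (A : U -> 'Hom(V, W)) (B : U -> 'Hom(T, V)) x :
  differentiable A x -> differentiable B x ->
  differentiable (fun z => (A z \o B z)%VF) x.
Proof.
move=> dA dB.
have linr (C : 'Hom(V, W)) : linear (fun D : 'Hom(T, V) => (C \o D)%VF).
  by move=> a D E; rewrite comp_lfunDr comp_lfunZr.
pose compr C : {linear 'Hom(T, V) -> 'Hom(T, W)} :=
  HB.pack (fun D : 'Hom(T, V) => (C \o D)%VF)
    (GRing.isLinear.Build _ _ _ _ _ (linr C)).
have linl : linear (fun C => linfun (compr C)).
  move=> a C D; apply/lfunP => E.
  by rewrite add_lfunE scale_lfunE !lfunE /= comp_lfunDl comp_lfunZl.
pose compl : {linear 'Hom(V, W) -> 'Hom('Hom(T, V), 'Hom(T, W))} :=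
  HB.pack (fun C => linfun (compr C)) (GRing.isLinear.Build _ _ _ _ _ linl).
have -> : (fun z => (A z \o B z)%VF) = (fun z => (compl \o A) z (B z)).
  by apply/funext => z; rewrite -[RHS]/(linfun (compr (A z)) (B z)) lfunE.
apply: differentiable_apply => //; apply: differentiable_comp => //.
exact: lin_differentiable.
Qed.

End FiniteDimensional.

Definition twice_differentiable (R : realType) (U V : normedVectType R)
  (F : U -> V) : Prop :=
  (forall x, differentiable F x) /\ (forall x, differentiable (nabla F) x).

(** * Partial derivatives of a map on a product *)

Section PartialDerivatives.
Variables (R : realType) (U P V : normedVectType R) (F : U -> P -> V).

Hypothesis dF : twice_differentiable (fun z : U * P => F z.1 z.2).

Let dpair1 x l : differentiable (fun z : U => (z, l : P)) x.
Proof. by apply: differentiable_pair => //; exact: differentiable_cst. Qed.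

Let dpair2 x l : differentiable (fun w : P => (x : U, w)) l.
Proof. by apply: differentiable_pair => //; exact: differentiable_cst. Qed.

Lemma differentiable_fst x l : differentiable (F^~ l) x.
Proof. exact: (differentiable_comp (dpair1 x l) (dF.1 _)). Qed.

Lemma differentiable_snd x l : differentiable (F x) l.
Proof. exact: (differentiable_comp (dpair2 x l) (dF.1 _)). Qed.

(* The differential of z |-> (z, l) is the same injection everywhere, so its
   value at 0 serves as the constant factor of nabla1 F in nabla1E. *)
Let nabla_pair1 x l :
  nabla (fun z : U => (z, l : P)) x = nabla (fun z : U => (z, 0 : P)) 0.
Proof.
apply/lfunP => u; rewrite !nablaE !diff_pair //; try exact: differentiable_cst.
by rewrite !diff_cst !diff_val.
Qed.

Let nabla_pair2 x l :
  nabla (fun w : P => (x : U, w)) l = nabla (fun w : P => (0 : U, w)) 0.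
Proof.
apply/lfunP => u; rewrite !nablaE !diff_pair //; try exact: differentiable_cst.
by rewrite !diff_cst !diff_val.
Qed.

(** With a constant right factor, the partial derivative inherits differentiability in either
    variable from the total derivative. *)
Lemma nabla1E x l :
  nabla1 F x l = (nabla (fun z : U * P => F z.1 z.2) (x, l)
                  \o nabla (fun z : U => (z, 0%R : P)) 0%R)%VF.
Proof.
rewrite -(nabla_pair1 x l); exact: (nabla_comp (dpair1 x l) (dF.1 _)).
Qed.

Lemma nabla2E x l :
  nabla2 F x l = (nabla (fun z : U * P => F z.1 z.2) (x, l)
                  \o nabla (fun w : P => (0%R : U, w)) 0%R)%VF.
Proof.
rewrite -(nabla_pair2 x l); exact: (nabla_comp (dpair2 x l) (dF.1 _)).
Qed.

Lemma differentiable_nabla1_fst x l : differentiable ((nabla1 F)^~ l) x.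
Proof.
rewrite (_ : (nabla1 F)^~ l = fun z =>
  (nabla (fun z : U * P => F z.1 z.2) (z, l)
   \o nabla (fun z : U => (z, 0%R : P)) 0%R)%VF); last first.
  by apply/funext => z; exact: nabla1E.
apply: differentiable_comp_lfun; last exact: differentiable_cst.
exact: (differentiable_comp (dpair1 x l) (dF.2 _)).
Qed.

Lemma differentiable_nabla1_snd x l : differentiable (nabla1 F x) l.
Proof.
rewrite (_ : nabla1 F x = fun w => (nabla (fun z : U * P => F z.1 z.2) (x, w)
   \o nabla (fun z : U => (z, 0%R : P)) 0%R)%VF); last first.
  by apply/funext => z; exact: nabla1E.
apply: differentiable_comp_lfun; last exact: differentiable_cst.
exact: (differentiable_comp (dpair2 x l) (dF.2 _)).
Qed.

Lemma differentiable_nabla2_snd x l : differentiable (nabla2 F x) l.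
Proof.
rewrite (_ : nabla2 F x = fun w => (nabla (fun z : U * P => F z.1 z.2) (x, w)
   \o nabla (fun w : P => (0%R : U, w)) 0%R)%VF); last first.
  by apply/funext => z; exact: nabla2E.
apply: differentiable_comp_lfun; last exact: differentiable_cst.
exact: (differentiable_comp (dpair2 x l) (dF.2 _)).
Qed.

End PartialDerivatives.

(** * Second-order chain rules *)

Lemma smooth_twice_differentiable (R : realType) (U V : normedVectType R)
  (K : U -> V) : smooth K -> twice_differentiable K.
Proof. by move=> sK; case: (sK 2%N) => dK [ddK _]. Qed.

(** A first-order chain rule, evaluated at a fixed [v], has sides of the form [A (g z) (B z v)];
    this rule differentiates it once more. *)
Lemma nabla_comp_apply (R : realType) (U V W S T : normedVectType R)
  (A : V -> 'Hom(W, T)) (g : U -> V) (B : U -> 'Hom(S, W)) v x u :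
  differentiable g x -> differentiable A (g x) -> differentiable B x ->
  nabla (fun z => A (g z) (B z v)) x u =
    nabla A (g x) (nabla g x u) (B x v) + A (g x) (nabla B x u v).
Proof.
move=> dg dA dB; have dBv : differentiable (fun z => B z v) x.
  by apply: differentiable_apply => //; exact: differentiable_cst.
rewrite (nabla_apply (differentiable_comp dg dA) dBv) nabla_comp // comp_lfunE.
by rewrite nabla_apply_cst.
Qed.

Lemma nabla2_comp (R : realType) (U V W : normedVectType R)
  (F : U -> V) (K : V -> W) x u v :
  twice_differentiable F -> twice_differentiable K ->
  nabla (nabla (K \o F)) x u v =
    nabla (nabla K) (F x) (nabla F x u) (nabla F x v)
    + nabla K (F x) (nabla (nabla F) x u v).
Proof.
move=> [dF ddF] [dK ddK].
have eKF : nabla (K \o F) = fun z => (nabla K (F z) \o nabla F z)%VF.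
  by apply/funext => z; exact: nabla_comp.
(* The fixed vector [v] moves under the outer derivative, so that a [W]-valued function is
   differentiated. *)
rewrite -nabla_apply_cst; last first.
  rewrite eKF; apply: differentiable_comp_lfun => //.
  exact: (differentiable_comp (dF x) (ddK _)).
rewrite -nabla_comp_apply //; congr (nabla _ x u).
by apply/funext => z; rewrite eKF comp_lfunE.
Qed.

(** A trivial kernel makes [A^-1] a left inverse; bijectivity makes it two-sided. *)
Lemma bij_lfunK (R : realType) (S T : vectType R) (A : 'Hom(S, T)) :
  bijective A ->
  cancel A (A^-1)%VF /\ cancel (A^-1)%VF A.
Proof.
move=> bijA; have AK : cancel A (A^-1)%VF.
  by apply: lker0_lfunK; apply/lker0P; exact: bij_inj.
by split=> //; exact/(bij_can_sym bijA).
Qed.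

(** * Derivatives of the equivariance relation *)

Section Equivariance.
Variables (R : realType) (U V P : normedVectType R).
Variables (f : U -> V) (H : U -> P -> U) (G : V -> P -> V).
Hypotheses (df : twice_differentiable f)
  (dH : twice_differentiable (fun z : U * P => H z.1 z.2))
  (dG : twice_differentiable (fun z : V * P => G z.1 z.2))
  (fHG : forall x l, f (H x l) = G (f x) l).

Lemma equivariance_nabla1 x l :
  (nabla f (H x l) \o nabla1 H x l = nabla1 G (f x) l \o nabla f x)%VF.
Proof.
have dHx := differentiable_fst dH x l.
have dGy := differentiable_fst dG (f x) l.
rewrite -(nabla_comp dHx (df.1 _)) -(nabla_comp (df.1 _) dGy).
by congr nabla; apply/funext => z /=; exact: fHG.
Qed.

Lemma equivariance_nabla2 x l :
  (nabla f (H x l) \o nabla2 H x l = nabla2 G (f x) l)%VF.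
Proof.
have dHl := differentiable_snd dH x l.
rewrite -(nabla_comp dHl (df.1 _)).
by congr nabla; apply/funext => z /=; exact: fHG.
Qed.

Lemma equivariance_nabla11 x l w v :
  nabla (nabla f) (H x l) (nabla1 H x l w) (nabla1 H x l v)
    + nabla f (H x l) (nabla1 (nabla1 H) x l w v) =
  nabla1 (nabla1 G) (f x) l (nabla f x w) (nabla f x v)
    + nabla1 G (f x) l (nabla (nabla f) x w v).
Proof.
have dHx := differentiable_fst dH x l.
have ddHx := differentiable_nabla1_fst dH x l.
have ddGy := differentiable_nabla1_fst dG (f x) l.
rewrite -(nabla_comp_apply v w dHx (df.2 _) ddHx).
rewrite -(nabla_comp_apply v w (df.1 x) ddGy (df.2 x)).
congr (nabla _ x w); apply/funext => z.
by have /lfunP/(_ v) := equivariance_nabla1 z l; rewrite !comp_lfunE.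
Qed.

(** This is the derivative of [equivariance_nabla1] in the parameter; [nabla f x v] is constant
    there, hence the single term on the right. *)
Lemma equivariance_nabla12 x l u v :
  nabla (nabla f) (H x l) (nabla2 H x l u) (nabla1 H x l v)
    + nabla f (H x l) (nabla2 (nabla1 H) x l u v) =
  nabla2 (nabla1 G) (f x) l u (nabla f x v).
Proof.
have dHl := differentiable_snd dH x l.
have ddHl := differentiable_nabla1_snd dH x l.
have ddGl := differentiable_nabla1_snd dG (f x) l.
rewrite -(nabla_comp_apply v u dHl (df.2 _) ddHl).
rewrite -(nabla_apply_cst (nabla f x v) u ddGl).
congr (nabla _ l u); apply/funext => m.
by have /lfunP/(_ v) := equivariance_nabla1 x m; rewrite !comp_lfunE.
Qed.

Lemma equivariance_nabla22 x l u v :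
  nabla (nabla f) (H x l) (nabla2 H x l u) (nabla2 H x l v)
    + nabla f (H x l) (nabla2 (nabla2 H) x l u v) =
  nabla2 (nabla2 G) (f x) l u v.
Proof.
have dHl := differentiable_snd dH x l.
have ddHl := differentiable_nabla2_snd dH x l.
have ddGl := differentiable_nabla2_snd dG (f x) l.
rewrite -(nabla_comp_apply v u dHl (df.2 _) ddHl).
rewrite -(nabla_apply_cst v u ddGl).
congr (nabla _ l u); apply/funext => m.
by have /lfunP/(_ v) := equivariance_nabla2 x m; rewrite !comp_lfunE.
Qed.

(** * Solving for the second derivative of [f] at a good position *)

Section GoodPosition.
Variables (x : U) (l : P).
Hypotheses (bijH : bijective (nabla1 H x l))
  (bijG : bijective (nabla1 G (f x) l)).

Local Notation y := (f x).
Local Notation Hinv := ((nabla1 H x l)^-1)%VF.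
Local Notation Ginv := ((nabla1 G y l)^-1)%VF.
Local Notation X := (Hinv \o nabla2 H x l)%VF.
Local Notation Y := (Ginv \o nabla2 G y l)%VF.

Let HK b : nabla1 H x l (Hinv b) = b.
Proof. by have [_] := bij_lfunK bijH; apply. Qed.

Let GK b : Ginv (nabla1 G y l b) = b.
Proof. by have [+ _] := bij_lfunK bijG; apply. Qed.

Let HX u : nabla1 H x l (X u) = nabla2 H x l u.
Proof. by rewrite comp_lfunE HK. Qed.

(** With both inverses moved across, the first-order relation trades the derivative of [f] at
    [H x l] for the one at [x]. *)
Let fHE a : nabla f x (Hinv a) = Ginv (nabla f (H x l) a).
Proof.
have /lfunP/(_ (Hinv a)) := equivariance_nabla1 x l.
by rewrite !comp_lfunE HK => ->; rewrite GK.
Qed.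

Lemma equivariance_generator u : nabla f x (X u) = Y u.
Proof.
have /lfunP/(_ u) := equivariance_nabla2 x l.
by rewrite !comp_lfunE fHE => ->.
Qed.

Lemma equivariance_hessian1 u v :
  nabla (nabla f) x (X u) v =
  - nabla f x (Hinv (nabla2 (nabla1 H) x l u v))
  + nabla f x (Hinv (nabla1 (nabla1 H) x l (X u) v))
  + Ginv (nabla2 (nabla1 G) y l u (nabla f x v))
  - Ginv (nabla1 (nabla1 G) y l (Y u) (nabla f x v)).
Proof.
have := equivariance_nabla11 x l (X u) v.
rewrite HX equivariance_generator.
(* Applying [Ginv] isolates the second derivative of [f] at [x]. *)
move/(congr1 Ginv); rewrite !linearD /= GK => /(canLR (addKr _)) <-.
(* The mixed relation reintroduces the second derivative of [f] at [H x l] on the right, where it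
   matches the left; the mixed derivative of [H] cancels. *)
rewrite -equivariance_nabla12 !fHE linearD /= [RHS]addrC; congr (_ + _).
by rewrite [RHS]addrC addrA addrK.
Qed.

(** Putting [X v] for [v] in [equivariance_hessian1] would keep the mixed derivatives. Here [HX]
    acts in both slots, so that [equivariance_nabla22] applies and pure parameter derivatives
    appear. *)
Lemma equivariance_hessian2 u v :
  nabla (nabla f) x (X u) (X v) =
  - nabla f x (Hinv (nabla2 (nabla2 H) x l u v))
  + nabla f x (Hinv (nabla1 (nabla1 H) x l (X u) (X v)))
  + Ginv (nabla2 (nabla2 G) y l u v)
  - Ginv (nabla1 (nabla1 G) y l (Y u) (Y v)).
Proof.
have := equivariance_nabla11 x l (X u) (X v).
rewrite !HX !equivariance_generator.
move/(congr1 Ginv); rewrite !linearD /= GK => /(canLR (addKr _)) <-.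
rewrite -equivariance_nabla22 !fHE linearD /= [RHS]addrC; congr (_ + _).
by rewrite [RHS]addrC addrA addrK.
Qed.
End GoodPosition.
End Equivariance.

(** * Transfer from [f] to [L] by the chain rule *)

Theorem theorem1 (R : realType) (d c p : nat)
  (f : 'rV[R]_d -> 'rV[R]_c)
  (H : 'rV[R]_d -> 'rV[R]_p -> 'rV[R]_d)
  (G : 'rV[R]_c -> 'rV[R]_p -> 'rV[R]_c)
  (ell : 'rV[R]_c -> R)
  (theta : 'rV[R]_d) (lambda : 'rV[R]_p)
  (hfHG : continuous_equivariance f H G)
  (hell : smooth ell)
  (hgood : good_position f H G theta lambda) :
  let L := ell \o f in
  let y := f theta in
  let Hinv := ((nabla1 H theta lambda)^-1)%VF in
  let Ginv := ((nabla1 G y lambda)^-1)%VF in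
  let X := (Hinv \o nabla2 H theta lambda)%VF in
  let Y := (Ginv \o nabla2 G y lambda)%VF in
  [/\ (nabla L theta \o X = nabla ell y \o Y)%VF,
      (nabla (nabla L) theta \o X =
         (nabla (nabla ell) y \o Y \o_2 nabla f theta)
         - (nabla ell y \o nabla f theta \o Hinv
              \o_t nabla2 (nabla1 H) theta lambda)
         + (nabla ell y \o nabla f theta \o Hinv
              \o_t nabla1 (nabla1 H) theta lambda \o X)
         + (nabla ell y \o Ginv
              \o_t nabla2 (nabla1 G) y lambda \o_2 nabla f theta)
         - (nabla ell y \o Ginv
              \o_t nabla1 (nabla1 G) y lambda \o Y \o_2 nabla f theta))%VF
    & (nabla (nabla L) theta \o X \o_2 X =
         (nabla (nabla ell) y \o Y \o_2 Y)
         - (nabla ell y \o nabla f theta \o Hinv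
              \o_t nabla2 (nabla2 H) theta lambda)
         + (nabla ell y \o nabla f theta \o Hinv
              \o_t nabla1 (nabla1 H) theta lambda \o X \o_2 X)
         + (nabla ell y \o Ginv
              \o_t nabla2 (nabla2 G) y lambda)
         - (nabla ell y \o Ginv
              \o_t nabla1 (nabla1 G) y lambda \o Y \o_2 Y))%VF].
Proof.
have [[sf _ _ fHG] sH sG] := hfHG; have [bijH bijG] := hgood.
have df := smooth_twice_differentiable sf.
have dH := smooth_twice_differentiable sH.
have dG := smooth_twice_differentiable sG.
have dell := smooth_twice_differentiable hell.
move=> L y Hinv Ginv X Y.
have fX := equivariance_generator df dH dG fHG bijH bijG.
split.
- apply/lfunP => u; rewrite /L (nabla_comp (df.1 _) (dell.1 _)).
  by have := fX u; rewrite !comp_lfunE => ->.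
- apply/lfunP => u; apply/lfunP => v.
  rewrite [in LHS]comp_lfunE [LHS](nabla2_comp theta (X u) v df dell).
  (* The chain rule gives a term in the second derivative of [ell], whose first slot [fX] turns into
     [Y u], and [nabla ell y] applied to the second derivative of [f], which the lemma expands. *)
  rewrite (equivariance_hessian1 df dH dG fHG bijH bijG) fX.
  rewrite !(add_lfunE, opp_lfunE, comp_sndE, comp_outE, comp_lfunE).
  by rewrite !(linearD, linearN) /= !addrA.
- apply/lfunP => u; apply/lfunP => v.
  rewrite [in LHS]comp_sndE [in LHS]comp_lfunE.
  rewrite [LHS](nabla2_comp theta (X u) (X v) df dell).
  rewrite (equivariance_hessian2 df dH dG fHG bijH bijG) !fX.
  rewrite !(add_lfunE, opp_lfunE, comp_sndE, comp_outE, comp_lfunE).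
  by rewrite !(linearD, linearN) /= !addrA.
Qed.
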